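(* Let $(U,Y_U,\mathbf 1,\omega)$ be a vertex operator algebra such that $U(1)$ consists of quasi-primary vectors, let $r=\sum_{t\ge0}\sum_{i=1}^{p_t}(\alpha_i^t\otimes\beta_i^t-\beta_i^t\otimes\alpha_i^t)$, with $\alpha_i^t,\beta_i^t\in U(t)$, be a diagonal skewsymmetric two-tensor in $U\widehat\otimes U$, let $T_r:U'\to U$ be given by $T_r(f)=\sum_{i=1}^{p_t}\big(\alpha_i^t\langle f,\beta_i^t\rangle-\beta_i^t\langle f,\alpha_i^t\rangle\big)$ for $f\in U(t)^*$, $t\ge0$, and let $T_R=T_r|_{U(1)^*}:U(1)^*\to U(1)$. If $T_r:U'\to U$ is a $0$-relative Rota-Baxter operator, then $T_R$ is a relative Rota-Baxter operator of the Lie algebra $U(1)$ with respect to the module $U(1)^*$.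
   Context: The base field is $\mathbb C$. A vertex operator algebra (VOA) is understood in the usual sense and is $\mathbb N$-graded, $U=\bigoplus_{n\ge0}U(n)$, $\dim U(n)<\infty$, $U(n)$ being the eigenspace of $L(0)$ with eigenvalue $n$; $Y_U(a,z)=\sum_ma_mz^{-m-1}$, $Y_U(\omega,z)=\sum_nL(n)z^{-n-2}$. ''$U(1)$ consists of quasi-primary vectors'' means $L(1)U(1)=0$. $U\widehat\otimes U=\prod_{p,q\ge0}U(p)\otimes U(q)$, diagonal elements are those in $\prod_tU(t)\otimes U(t)$, and skewsymmetric means anti-invariant under the flip. Contragredient module: $U'=\bigoplus_nU(n)^*$, $\langle Y_{U'}(a,z)f,u\rangle=\langle f,Y_U(e^{zL(1)}(-z^{-2})^{L(0)}a,z^{-1})u\rangle$. For $a\in U$, $f\in U'$, $m\in\mathbb Z$: $a_mf=\mathrm{Res}_zz^mY_{U'}(a,z)f$, $f(m)a=\mathrm{Res}_zz^me^{zL(-1)}Y_{U'}(a,-z)f$. A linear map $T:U'\to U$ is an $m$-relative Rota-Baxter operator if $T(f)_mT(g)=T(T(f)_mg)+T(f(m)T(g))$ for all $f,g\in U'$. The first level $U(1)$ is regarded as a Lie algebra with bracket $[a,b]=a_0b$, acting on $U(1)^*$ by $\rho^*(a)f=a_0f$ (which is the dual of the representation $a\mapsto a_0$ on $U(1)$). A relative Rota-Baxter operator (of weight $0$, also called $\mathcal O$-operator) of a Lie algebra $\mathfrak g$ with respect to a module $(M,\rho)$ is a linear map $\mathcal T:M\to\mathfrak g$ with $[\mathcal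 T(u),\mathcal T(v)]=\mathcal T\big(\rho(\mathcal T(u))v\big)-\mathcal T\big(\rho(\mathcal T(v))u\big)$ for all $u,v\in M$. *)

(* Defs.v *)
From HB Require Import structures.
From mathcomp Require Import all_boot all_order all_algebra.
From mathcomp Require Import all_classical.
From mathcomp Require Import reals complex.
From mathcomp Require Import ring lra zify.

Set Implicit Arguments.
Unset Strict Implicit.
Unset Printing Implicit Defensive.

Import Order.TTheory GRing.Theory Num.Theory.
Local Open Scope classical_set_scope.
Local Open Scope ring_scope.

Section FiniteSums.
Variables (C : numFieldType) (V : lmodType C).

Lemma fsum_trunc (F : nat -> V) N : (forall i, (N <= i)%N -> F i = 0) ->
  \sum_(i \in [set: nat]) F i = \sum_(i < N) F i.
Proof.
move=> F0; rewrite fsbig_ord; apply/esym/fsbig_widen => // i [_ /=] /negP.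
by rewrite -leqNgt => /F0.
Qed.

End FiniteSums.

Section Subspaces.
Variables (C : numFieldType) (V : lmodType C) (S : submodClosed V).

(* The members of a closed predicate [S], as a vector space of its own. *)
Record subspace := Subspace { subspace_val :> V; subspaceP : subspace_val \in S }.

HB.instance Definition _ := [isSub for subspace_val].
HB.instance Definition _ := [Choice of subspace by <:].
HB.instance Definition _ := [SubChoice_isSubLmodule of subspace by <:].

End Subspaces.

(* The binomial coefficient "m choose i" for an arbitrary integer m. *)
Definition binz (C : numFieldType) (m : int) (i : nat) : C :=
  (\prod_(j < i) (m%:~R - j%:R)) / (i`!)%:R.
Arguments binz {C}.

(* [mode a n b] is a_n b, where Y(a,z) = sum_n a_n z^(-n-1); the Virasoro
   operator L(n) is the mode omega_(n+1).  The field [voa_jacobi] is the Jacobi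
   identity, written coefficient by coefficient (Borcherds' form).  Sums over
   [set: nat] are finite-support sums: here only finitely many terms are nonzero,
   by [voa_trunc].  The grading is indexed by nat: U(n) is the n-eigenspace of
   L(0), and U is the sum of these (automatically direct). *)
Record voa (C : numFieldType) := Voa {
  voa_car :> lmodType C;
  mode : voa_car -> int -> voa_car -> voa_car;
  vacuum : voa_car;
  omega : voa_car;
  voa_linearl : forall n b, linear (fun a => mode a n b);
  voa_linearr : forall a n, linear (mode a n);
  voa_trunc : forall a b, exists N : int, forall n, N <= n -> mode a n b = 0;
  voa_vacuum : forall n b, mode vacuum n b = if n == -1 then b else 0;
  voa_creation0 : forall a (n : int), 0 <= n -> mode a n vacuum = 0;
  voa_creation : forall a, mode a (-1) vacuum = a;
  voa_jacobi : forall a b c (l m n : int),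
    \sum_(i \in [set: nat])
       binz m i *: mode (mode a (l + i%:Z) b) (m + n - i%:Z) c
    = \sum_(i \in [set: nat]) ((-1) ^+ i * binz l i) *:
        (mode a (m + l - i%:Z) (mode b (n + i%:Z) c)
         - (-1) ^ l *: mode b (n + l - i%:Z) (mode a (m + i%:Z) c));
  voa_virasoro : exists c : C, forall (m n : int) u,
    mode omega (m + 1) (mode omega (n + 1) u)
    - mode omega (n + 1) (mode omega (m + 1) u)
    = (m - n)%:~R *: mode omega (m + n + 1) u
      + (if m + n == 0 then ((m ^+ 3 - m)%:~R / 12%:R * c) *: u else 0);
  voa_derivative : forall a n b,
    mode (mode omega 0 a) n b = - n%:~R *: mode a (n - 1) b;
  voa_grading : forall u, exists c : nat -> voa_car,
    [/\ forall n, mode omega 1 (c n) = n%:R *: c n,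
        exists N, forall n, (N <= n)%N -> c n = 0
      & u = \sum_(n \in [set: nat]) c n];
  voa_findim : forall n : nat, exists s : seq voa_car,
    forall u, mode omega 1 u = n%:R *: u ->
    exists c : 'I_(size s) -> C, u = \sum_i c i *: s`_i
}.

Section VoaTheory.
Variables (C : numFieldType) (U : voa C).
Implicit Types (a b u v : U) (n : nat).

Definition L (n : int) : U -> U := mode (omega U) (n + 1).

HB.instance Definition _ a (n : int) :=
  GRing.isLinear.Build C U U *:%R (mode a n) (voa_linearr a n).
HB.instance Definition _ (n : int) := GRing.Linear.on (L n).

(* [level n] is U(n). *)
Definition level (n : nat) : {pred U} := [pred u | L 0 u == n%:R *: u].

Lemma level_closed n : submod_closed (level n).
Proof.
split=> [|k u v]; rewrite !inE /=; first by rewrite linear0 scaler0.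
by move=> /eqP eu /eqP ev; rewrite linearP /= eu ev scalerDr !scalerA mulrC.
Qed.

HB.instance Definition _ n := GRing.isSubmodClosed.Build C U (level n)
  (level_closed n).

(* The homogeneous component of u in U(n). *)
Definition component (n : nat) (u : U) : U := projT1 (cid (voa_grading u)) n.

Let wt (w : int) u := L 0 u = w%:~R *: u.

Lemma levelP n u : reflect (wt n%:Z u) (u \in level n).
Proof. by rewrite inE /=; apply: eqP. Qed.

Lemma mode0l (n : int) b : mode (0 : U) n b = 0.
Proof.
have /eqP := @voa_linearl C U n b 1 0 0.
by rewrite !scale1r addr0 -[X in X == _]addr0 (inj_eq (addrI _)) eq_sym => /eqP.
Qed.

Lemma modeDl (n : int) b a a' : mode (a + a') n b = mode a n b + mode a' n b.
Proof. by have := @voa_linearl C U n b 1 a a'; rewrite !scale1r. Qed.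

Lemma modeZl (n : int) b k a : mode (k *: a) n b = k *: mode a n b.
Proof. by have := @voa_linearl C U n b k a 0; rewrite addr0 mode0l addr0. Qed.

Lemma eigen_indep (I : eqType) (ev : I -> C) (s : seq I) (d : I -> U) :
  uniq s -> {in s &, injective ev} -> {in s, forall x, L 0 (d x) = ev x *: d x} ->
  \sum_(x <- s) d x = 0 -> {in s, forall x, d x = 0}.
Proof.
elim: s d => [|x s IH] d //= /andP[xs us] inj Ld; rewrite big_cons => S0.
have step : {in s, forall y, (ev y - ev x) *: d y = 0}.
  apply: (IH (fun y => (ev y - ev x) *: d y)) => //.
  - by move=> y z ys zs; apply: inj; rewrite inE ?ys ?zs orbT.
  - move=> y ys /=; rewrite linearZ /= Ld ?inE ?ys ?orbT //.
    by rewrite !scalerA mulrC.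
  have /(congr1 (fun v => L 0 v - ev x *: v)) := S0.
  rewrite linear0 scaler0 subr0 linearD linear_sum /= Ld ?inE ?eqxx //.
  rewrite scalerDr opprD addrACA subrr add0r scaler_sumr -sumrB => S1.
  rewrite -[RHS]S1; by apply: eq_big_seq => y ys; rewrite Ld ?inE ?ys ?orbT // scalerBl.
have ds : {in s, forall y, d y = 0}.
  move=> y ys; have /eqP := step y ys; rewrite scaler_eq0 subr_eq0.
  case/orP => [/eqP e|/eqP //]; case/negP: xs.
  by rewrite -(inj y x _ _ e) ?inE ?eqxx ?ys ?orbT.
move=> y; rewrite inE => /orP[/eqP->|/ds //].
by move: S0; rewrite big_seq big1 ?addr0.
Qed.

Lemma componentP u :
  [/\ forall n, component n u \in level n,
      exists N, forall n, (N <= n)%N -> component n u = 0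
    & u = \sum_(n \in [set: nat]) component n u].
Proof.
rewrite /component; case: cid => c /= [c1 c2 c3]; split=> // n.
by rewrite inE /=; apply/eqP; exact: c1.
Qed.

Lemma component_sum u : exists N,
  (forall n, (N <= n)%N -> component n u = 0) /\ u = \sum_(n < N) component n u.
Proof.
have [_ [N cN] e] := componentP u; exists N; split=> //.
by rewrite {1}e (fsum_trunc cN).
Qed.

Lemma wt_neg (w : int) u : w < 0 -> wt w u -> u = 0.
Proof.
move=> w0 wu; have [N [cN e]] := component_sum u.
pose d (x : option nat) := if x is Some n then component n u else - u.
pose ev (x : option nat) : C := if x is Some n then n%:R else w%:~R.
have wN n : (w%:~R == n%:R :> C) = false.
  by rewrite pmulrn eqr_int; apply/negbTE; rewrite lt_eqF // (lt_le_trans w0).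
suff h : d None = 0 by apply/eqP; rewrite -oppr_eq0; apply/eqP.
apply: (@eigen_indep _ ev (None :: map Some (iota 0 N)) d).
- rewrite /= map_inj_uniq ?iota_uniq ?andbT; last by move=> ? ? [].
  by apply/negP => /mapP[].
- move=> [x|] [y|] _ _ //=.
  + by move=> /eqP; rewrite eqr_nat => /eqP->.
  + by move/esym/eqP; rewrite wN.
  + by move/eqP; rewrite wN.
- move=> [x|] _ /=.
    by have [/(_ x)+ _ _] := componentP u; rewrite inE /= => /eqP.
  by rewrite linearN /= wu scalerN.
- rewrite big_cons big_map /= -[iota 0 N]/(iota 0 N).
  have -> : iota 0 N = index_iota 0 N by rewrite /index_iota subn0.
  by rewrite big_mkord -e addNr.
- by rewrite inE.
Qed.

Lemma component_level n u : u \in level n ->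
  forall k, component k u = if k == n then u else 0.
Proof.
move=> un k; have [N [cN e]] := component_sum u.
pose M := (N + n + k).+1.
have eM : \sum_(i < M) component i u = u.
  rewrite -(fsum_trunc (N := M)); last first.
    by move=> i Mi; apply: cN; apply: leq_trans Mi; rewrite /M -addnA -addnS leq_addr.
  by rewrite (fsum_trunc cN) -e.
pose d i := component i u - if i == n then u else 0.
apply/eqP; rewrite -subr_eq0; apply/eqP; rewrite -/(d k).
apply: (@eigen_indep _ (fun i : nat => i%:R) (index_iota 0 M) d).
- exact: iota_uniq.
- by move=> x y _ _ /eqP; rewrite eqr_nat => /eqP.
- move=> i _; rewrite /d linearB /=.
  have [/(_ i)+ _ _] := componentP u; rewrite inE /= => /eqP->.
  rewrite scalerBr; case: eqP => [->|_]; last by rewrite linear0 scaler0.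
  by move: un; rewrite inE /= => /eqP->.
- rewrite /d sumrB !big_mkord eM -big_mkcond /=.
  have nM : (n < M)%N by rewrite /M ltnS -addnA addnCA leq_addr.
  by rewrite (big_pred1 (Ordinal nM)) ?subrr // => i; rewrite -val_eqE.
- by rewrite mem_index_iota /= /M ltnS leq_addl.
Qed.

Lemma omega_commutator (n : int) b u :
  L 0 (mode b n u) - mode b n (L 0 u)
  = mode (L (-1) b) (n + 1) u + mode (L 0 b) n u.
Proof.
have := voa_jacobi (omega U) b u 0 1 n.
rewrite (fsum_trunc (N := 2)); last first.
  move=> [|[|i]] // _; rewrite /binz big_ord_recl big_ord_recl /=.
  by rewrite /bump /= subrr mul0r mulr0 mul0r scale0r.
rewrite (fsum_trunc (N := 1)); last first.
  move=> [|i] // _; rewrite /binz big_ord_recl /= subr0 mul0r mul0r mulr0.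
  by rewrite scale0r.
rewrite !big_ord_recl !big_ord0 /= /binz big_ord_recl !big_ord0 /bump /=.
rewrite !subr0 !addr0 !fact0 !factS !divr1 !mulr1 !scale1r => E.
rewrite /L (_ : -1 + 1 = 0 :> int) // (_ : 0 + 1 = 1 :> int) //.
by move: E; rewrite addn0 [1 + n - _]addrC addKr [n + 1]addrC => <-.
Qed.

Lemma wt_mode (p q n : int) a b : wt p a -> wt q b -> wt (p + q - n - 1) (mode a n b).
Proof.
move=> wa wb; have := omega_commutator n a b.
rewrite wb linearZ /= wa modeZl /L voa_derivative addrK => /(canRL (subrK _)).
rewrite -/(L 0) -!scalerDl /wt => ->; congr (_ *: _).
rewrite !rmorphB !rmorphD /=; ring.
Qed.

Lemma wt_omega : wt 2 (omega U).
Proof.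
have [c /(_ 0 (-2) (vacuum U))] := @voa_virasoro C U.
have -> : (0 + (-2) == 0 :> int) = false by [].
rewrite addr0 (_ : -2 + 1 = -1 :> int) // (_ : 0 + 1 = 1 :> int) //.
rewrite voa_creation voa_creation0 // linear0 subr0.
by rewrite opprK.
Qed.

Lemma wt_L (n w : int) u : wt w u -> wt (w - n) (L n u).
Proof.
move=> wu; have := wt_mode (n + 1) wt_omega wu.
by rewrite (_ : 2 + w - (n + 1) - 1 = w - n) //; ring.
Qed.

Lemma wt_iter_L1 (w : int) u j : wt w u -> wt (w - j%:Z) (iter j (L 1) u).
Proof.
move=> wu; elim: j => [|j IH]; first by rewrite subr0.
by have := wt_L 1 IH; rewrite (_ : w - j%:Z - 1 = w - j.+1%:Z) //; lia.
Qed.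

Lemma iter_L1_0 p j u : u \in level p -> (p < j)%N -> iter j (L 1) u = 0.
Proof.
move=> /levelP up pj; apply: (wt_neg (w := p%:Z - j%:Z)); first by lia.
exact: wt_iter_L1.
Qed.

Lemma iter_L0 j : iter j (L 1) 0 = 0.
Proof. by elim: j => //= j ->; rewrite linear0. Qed.

(* The restricted dual U' = (+)_n U(n)^*, realized as the linear forms on U
   vanishing on all but finitely many U(n); a form on U(n) is extended by 0. *)
Definition restricted_dual : {pred (U -> C^o)} := [pred f : U -> C^o |
  `[< linear f /\ exists N, forall n, (N <= n)%N -> {in level n, f =1 cst 0} >]].

Lemma restricted_dual_closed : submod_closed restricted_dual.
Proof.
split=> [|k f g]; rewrite !inE.
  split; last by exists 0%N.
  by move=> k u v /=; rewrite scaler0 addr0.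
move=> [lf [N fN]] [lg [M gM]]; split.
  move=> h u v /=; have -> w : (k *: f + g) w = k *: f w + g w by [].
  by rewrite lf lg !scalerDr !scalerA [k * h]mulrC addrACA.
exists (maxn N M) => n; rewrite geq_max => /andP[Nn Mn] u un.
have -> : (k *: f + g) u = k *: f u + g u by [].
by rewrite (fN _ Nn _ un) (gM _ Mn _ un) scaler0 addr0.
Qed.

HB.instance Definition _ := GRing.isSubmodClosed.Build C (U -> C^o)
  restricted_dual restricted_dual_closed.

Definition dual := subspace restricted_dual.
Implicit Types f g : dual.

(* <f, u> *)
Definition pairing f (u : U) : C := subspace_val f u.
Arguments pairing : simpl never.

Lemma pairingP f : linear (pairing f : U -> C^o).
Proof. by have := subspaceP f; rewrite inE => -[]. Qed.
HB.instance Definition _ f :=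
  GRing.isLinear.Build C U C^o *:%R (pairing f) (pairingP f).

Lemma pairingDl f g u : pairing (f + g) u = pairing f u + pairing g u.
Proof. by []. Qed.
Lemma pairingZl k f u : pairing (k *: f) u = k * pairing f u.
Proof. by []. Qed.

Lemma pairing_vanish f : exists N, forall (w : int) u,
  N%:Z <= w -> wt w u -> pairing f u = 0.
Proof.
have := subspaceP f; rewrite inE => -[_ [N fN]]; exists N => -[w|//] u.
by rewrite lez_nat => Nw wu; apply: (fN w Nw); apply/levelP.
Qed.

(* <a_m f, u> is the coefficient of z^(-m-1) in
   <f, Y(e^(zL(1)) (-z^(-2))^(L(0)) a, z^(-1)) u>.  The component a_p of a in
   U(p) contributes (-1)^p z^(j-2p) / j! Y(L(1)^j a_p, z^(-1)) for each j, and
   Y(v, z^(-1)) = sum_n v_n z^(n+1), whence n = 2p - j - m - 2. *)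
Definition dual_mode_form (a : U) (m : int) f : U -> C^o := fun u =>
  \sum_(p \in [set: nat]) \sum_(j \in [set: nat]) (-1) ^+ p / (j`!)%:R *
    pairing f (mode (iter j (L 1) (component p a))
                    ((2 * p)%N%:Z - j%:Z - m - 2) u).

Lemma dual_mode_formE a : exists N, forall (m : int) f u, dual_mode_form a m f u =
  \sum_(p < N) \sum_(j < p.+1) (-1) ^+ p / (j`!)%:R *
    pairing f (mode (iter j (L 1) (component p a))
                    ((2 * p)%N%:Z - j%:Z - m - 2) u).
Proof.
have [N [cN _]] := component_sum a; exists N => m f u.
rewrite /dual_mode_form (@fsum_trunc C C^o _ N).
  apply: eq_bigr => p _; rewrite (@fsum_trunc C C^o _ p.+1) // => j pj.
  rewrite (@iter_L1_0 p) //; last by have [] := componentP a.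
  by rewrite mode0l linear0 mulr0.
move=> p /cN ->; rewrite fsbig1 // => j _.
by rewrite iter_L0 mode0l linear0 mulr0.
Qed.

Lemma dual_mode_wt a (m : int) f (N : nat) :
  (forall p, (N <= p)%N -> component p a = 0) ->
  forall (w Q : int) u, (forall (v : int) x, Q <= v -> wt v x -> pairing f x = 0) ->
  Q + N%:Z - m - 1 <= w -> wt w u -> dual_mode_form a m f u = 0.
Proof.
move=> aN w Q u fQ Qw wu; rewrite /dual_mode_form fsbig1 // => p _.
rewrite fsbig1 // => j _.
have [pN|Np] := ltnP p N; last by rewrite aN // iter_L0 mode0l linear0 mulr0.
have wa : wt p%:Z (component p a) by apply/levelP; have [] := componentP a.
have wm := wt_mode ((2 * p)%N%:Z - j%:Z - m - 2) (wt_iter_L1 j wa) wu.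
by rewrite (fQ _ _ _ wm) ?mulr0 //; lia.
Qed.

Lemma dual_modeP a m f : dual_mode_form a m f \in restricted_dual.
Proof.
rewrite inE; split.
  have [N E] := dual_mode_formE a => k u v; rewrite !E.
  rewrite scaler_sumr -big_split; apply: eq_bigr => p _ /=.
  rewrite scaler_sumr -big_split; apply: eq_bigr => j _ /=.
  by rewrite !linearP /= mulrDr scalerAr.
have [N [aN _]] := component_sum a; have [Q fQ] := pairing_vanish f.
exists (Q + N + absz (m + 1)%R)%N => n hn u /levelP un.
by apply: (dual_mode_wt aN fQ _ un); lia.
Qed.

(* a_m f *)
Definition dual_mode (a : U) (m : int) f : dual := Subspace (dual_modeP a m f).

(* f(m)a = Res_z z^m e^(zL(-1)) Y_{U'}(a,-z) f, where L(-1) acts on U' as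
   omega_0: the coefficient of z^(-m-1) collects the a_n f with n = m + j. *)
Definition dual_mode_right f (m : int) (a : U) : dual :=
  \sum_(j \in [set: nat]) ((-1) ^ (m + j%:Z + 1) / (j`!)%:R) *:
    iter j (dual_mode (omega U) 0) (dual_mode a (m + j%:Z) f).

Definition voa_relative_rota_baxter (m : int) (T : {linear dual -> U}) :=
  forall f g : dual, mode (T f) m (T g)
    = T (dual_mode (T f) m g) + T (dual_mode_right f m (T g)).

(* U(n)^*, as a subspace of U'. *)
Definition dual_level (n : nat) : {pred dual} := [pred f |
  `[< forall k, k != n -> {in level k, pairing f =1 cst 0} >]].

Lemma dual_level_closed n : submod_closed (dual_level n).
Proof.
split=> [|k f g]; rewrite !inE; first by [].
move=> fn gn i ki u ui.
by rewrite pairingDl pairingZl (fn _ ki _ ui) (gn _ ki _ ui) mulr0 addr0.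
Qed.
HB.instance Definition _ n := GRing.isSubmodClosed.Build C dual
  (dual_level n) (dual_level_closed n).

Lemma bracketP (a b : subspace (level 1)) : mode a 0 b \in level 1.
Proof.
apply/levelP; have /levelP wa := subspaceP a; have /levelP wb := subspaceP b.
exact: (wt_mode 0 wa wb).
Qed.

(* [a, b] = a_0 b on U(1). *)
Definition bracket (a b : subspace (level 1)) : subspace (level 1) :=
  Subspace (bracketP a b).

Lemma coadjointP (a : subspace (level 1)) (f : subspace (dual_level 1)) :
  dual_mode a 0 (subspace_val f) \in dual_level 1.
Proof.
rewrite inE => k k1 u /levelP uk.
rewrite /pairing /= /dual_mode_form fsbig1 // => p _; rewrite fsbig1 // => j _.
rewrite (component_level (subspaceP a)); case: eqP => [->|_]; last first.
  by rewrite iter_L0 mode0l linear0 mulr0.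
have /levelP wa := subspaceP a.
have := wt_mode ((2 * 1)%N%:Z - j%:Z - 0 - 2) (wt_iter_L1 j wa) uk.
set v := mode _ _ _ => wv.
have {}wv : wt k%:Z v.
  by move: wv; rewrite (_ : _ - _ - 1 = k%:Z) //; lia.
have := subspaceP f; rewrite inE => /(_ k k1 v) -> //; last first.
  by apply/levelP.
by rewrite mulr0.
Qed.

(* rho^*(a) f = a_0 f on U(1)^*. *)
Definition coadjoint (a : subspace (level 1)) (f : subspace (dual_level 1)) :
    subspace (dual_level 1) :=
  Subspace (coadjointP a f).

(* A diagonal skewsymmetric two-tensor of the completed tensor square, given by
   its presentation sum_t sum_i (alpha_i^t (x) beta_i^t - beta_i^t (x) alpha_i^t). *)
Record diagonal_skew_tensor := DiagonalSkewTensor {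
  tensor_size : nat -> nat;
  alpha : forall t, 'I_(tensor_size t) -> U;
  beta : forall t, 'I_(tensor_size t) -> U;
  alpha_level : forall t i, @alpha t i \in level t;
  beta_level : forall t i, @beta t i \in level t }.

Variable r : diagonal_skew_tensor.

(* Only the summand t contributes when f lies in U(t)^*. *)
Definition tensor_map f : U := \sum_(t \in [set: nat]) \sum_(i < tensor_size r t)
  (pairing f (beta i) *: alpha i - pairing f (alpha i) *: beta i).

Lemma tensor_map_linear : linear tensor_map.
Proof.
move=> k f g; have [N fN] := pairing_vanish f; have [M gM] := pairing_vanish g.
have trunc (h : dual) : (forall t u, (maxn N M <= t)%N -> u \in level t ->
    pairing h u = 0) -> tensor_map h = \sum_(t < maxn N M)
      \sum_(i < tensor_size r t)
        (pairing h (beta i) *: alpha i - pairing h (alpha i) *: beta i).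
  move=> h0; rewrite /tensor_map (fsum_trunc (N := maxn N M)) // => t Nt.
  rewrite big1 // => i _.
  by rewrite !(h0 t) ?alpha_level ?beta_level // !scale0r subrr.
have f0 t u : (maxn N M <= t)%N -> u \in level t -> pairing f u = 0.
  by rewrite geq_max => /andP[Nt _] /levelP; apply: fN; rewrite lez_nat.
have g0 t u : (maxn N M <= t)%N -> u \in level t -> pairing g u = 0.
  by rewrite geq_max => /andP[_ Nt] /levelP; apply: gM; rewrite lez_nat.
rewrite (trunc _ f0) (trunc _ g0) trunc; last first.
  by move=> t u ht ut; rewrite pairingDl pairingZl (f0 t) ?(g0 t) // mulr0 addr0.
rewrite scaler_sumr -big_split; apply: eq_bigr => t _ /=.
rewrite scaler_sumr -big_split; apply: eq_bigr => i _ /=.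
rewrite !pairingDl !pairingZl !scalerDl !scalerDr !scalerN !scalerA opprD.
by rewrite addrACA.
Qed.
HB.instance Definition _ :=
  GRing.isLinear.Build C dual U *:%R tensor_map tensor_map_linear.

Lemma tensor_map_level n f : f \in dual_level n -> tensor_map f =
  \sum_(i < tensor_size r n)
    (pairing f (beta i) *: alpha i - pairing f (alpha i) *: beta i).
Proof.
rewrite inE => fn; rewrite /tensor_map -(fsbig_widen [set n]) ?fsbig_set1 //.
move=> t [_ /= /eqP tn]; rewrite big1 // => i _.
by rewrite !(fn t tn) ?alpha_level ?beta_level // !scale0r subrr.
Qed.

Lemma tensor_map_restrictP n (f : subspace (dual_level n)) :
  tensor_map (subspace_val f) \in level n.
Proof.
rewrite (tensor_map_level (subspaceP f)); apply: rpred_sum => i _.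
by rewrite rpredB // rpredZ // ?alpha_level ?beta_level.
Qed.

(* The restriction U(n)^* -> U(n) of T_r. *)
Definition tensor_map_restrict n (f : subspace (dual_level n)) :
  subspace (level n) := Subspace (tensor_map_restrictP f).

Lemma tensor_map_restrict_linear n : linear (@tensor_map_restrict n).
Proof. by move=> k f g; apply: val_inj; rewrite /= linearP. Qed.
HB.instance Definition _ n := GRing.isLinear.Build C (subspace (dual_level n))
  (subspace (level n)) *:%R (@tensor_map_restrict n)
  (@tensor_map_restrict_linear n).

End VoaTheory.

Arguments level {C} U n.
Arguments dual_level {C} U n.
Arguments bracket {C} U a b.
Arguments coadjoint {C} U a f.
Arguments tensor_map_restrict {C U} r n f.

(* Relative Rota-Baxter operator (of weight 0) of the Lie algebra (g, br) with
   respect to the module (M, rho).  The notion involves the bracket and the action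
   only, so they are taken as data, without the Lie algebra and module axioms.
   For g = U(1) the bracket a_0 b satisfies the Jacobi identity, but without
   U(0) = C.1 it is antisymmetric only modulo L(-1)U(0). *)
Definition relative_rota_baxter (C : numFieldType) (g M : lmodType C)
    (br : g -> g -> g) (rho : g -> M -> M) (T : {linear M -> g}) :=
  forall u v : M, br (T u) (T v) = T (rho (T u) v) - T (rho (T v) u).

(* Main.v *)
Require Import Defs.
From mathcomp Require Import all_boot all_order all_algebra.
From mathcomp Require Import all_classical.
From mathcomp Require Import reals complex.
From mathcomp Require Import zify.

(** For [f] in [U(1)^*] and [b] in [U(1)], the skewed action
    [f(0)b = sum_j (-1)^(j+1)/j! L(-1)^j b_j f] collapses to [- b_0 f]: the terms
    [j >= 2] vanish because [b_j f] would have weight [1 - j < 0], and the term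
    [j = 1] is [L(-1) h] with [h = b_1 f] in [U(0)^*], which pairs with [u] as
    [<h, L(1) u>]; only [u] in [U(1)] matters, and there [L(1) u = 0]. *)

Import Order.TTheory GRing.Theory Num.Theory.
Local Open Scope ring_scope.

Section DualModes.
Context {C : numFieldType} {U : voa C}.
Implicit Types (a b u : U) (f g h : dual U).

Lemma dual_eq_level f g :
  (forall n u, u \in level U n -> pairing f u = pairing g u) -> f = g.
Proof.
move=> fg; apply/val_inj/funext => u.
rewrite -[LHS]/(pairing f u) -[RHS]/(pairing g u).
have [N [_ ->]] := component_sum u; rewrite !linear_sum; apply: eq_bigr => n _.
by apply: fg; have [+ _ _] := componentP u; exact.
Qed.

(** So [a_m f] lies in the dual of level [p + q - m - 1]: in the contragredient formula every mode
    of [L(1)^j a] shifts weights by [m + 1 - p], whatever [j] is. *)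
Lemma dual_mode_level0 {p q k} {m : int} {a f u} :
  a \in level U p -> f \in dual_level U q -> u \in level U k ->
  k%:Z != p%:Z + q%:Z - m - 1 -> pairing (dual_mode a m f) u = 0.
Proof.
move=> ap fq uk kn; rewrite /pairing /= /dual_mode_form.
rewrite fsbig1 // => i _; rewrite fsbig1 // => j _.
rewrite (component_level ap); case: eqP => [->|_]; last first.
  by rewrite iter_L0 mode0l linear0 mulr0.
move/levelP: ap => wa; move/levelP: uk => wu.
have := wt_mode ((2 * p)%N%:Z - j%:Z - m - 2) (wt_iter_L1 j wa) wu.
set v := mode _ _ _; set w := (X in X%:~R) => wv.
have ew : w = k%:Z + m + 1 - p%:Z by rewrite /w; lia.
(* [w] is an integer, while levels are indexed by [nat]. *)
case: (ltP w 0) => [w0|w0]; first by rewrite (wt_neg w0 wv) linear0 mulr0.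
move: fq; rewrite inE => /(_ `|w|%N) fq.
rewrite [pairing f v](_ : _ = 0) ?mulr0 //; apply: fq; first by lia.
by apply/levelP; rewrite gez0_abs.
Qed.

(** Apply [[L(1), L(-2)] = 3 L(-1)] to the vacuum, with [omega = L(-2) 1]; there is no central
    term. *)
Lemma L1_omega : L 1 (omega U) = 0.
Proof.
have [c /(_ 1 (-2) (vacuum U))] := @voa_virasoro C U.
have -> : (1 + (-2) == 0 :> int) = false by [].
rewrite addr0 (_ : -2 + 1 = -1 :> int) // (_ : 1 + (-2) + 1 = 0 :> int) //.
by rewrite voa_creation !voa_creation0 // linear0 subr0 scaler0.
Qed.

(** As [omega] is quasi-primary of weight 2, only [p = 2], [j = 0] survives, with sign [(-1)^2] and
    mode [omega_2 = L(1)]. *)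
Lemma pairing_dual_translation h u :
  pairing (dual_mode (omega U) 0 h) u = pairing h (L 1 u).
Proof.
have om : omega U \in level U 2 by apply/levelP; exact: wt_omega.
have L1j j : (0 < j)%N -> iter j (L 1) (omega U) = 0.
  by case: j => // j _; rewrite iterSr L1_omega iter_L0.
rewrite {1}/pairing /= /dual_mode_form.
rewrite (@fsum_trunc C C^o _ 3); last first.
  move=> p p3; rewrite fsbig1 // => j _; rewrite (component_level om).
  by rewrite gtn_eqF // iter_L0 mode0l linear0 mulr0.
rewrite big_ord_recr /= big1 ?add0r; last first.
  move=> i _; rewrite fsbig1 // => j _; rewrite (component_level om).
  by rewrite ltn_eqF // iter_L0 mode0l linear0 mulr0.
rewrite (@fsum_trunc C C^o _ 1); last first.
  by move=> j j0; rewrite (component_level om) eqxx L1j // mode0l linear0 mulr0.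
by rewrite big_ord1 /= (component_level om) eqxx fact0 divr1 sqrrN expr1n mul1r.
Qed.

Lemma dual_mode_right_level1 b f :
  (forall a, a \in level U 1 -> L 1 a = 0) ->
  b \in level U 1 -> f \in dual_level U 1 ->
  dual_mode_right f 0 b = - dual_mode b 0 f.
Proof.
move=> quasi_primary b1 f1; rewrite /dual_mode_right (fsum_trunc (N := 2)); last first.
  move=> j j2; have -> : dual_mode b (0 + j%:Z) f = 0.
    apply: dual_eq_level => k u uk.
    by rewrite (dual_mode_level0 b1 f1 uk) //; lia.
  rewrite (_ : iter j _ 0 = 0) ?scaler0 //.
  elim: j {j2} => //= j ->; apply: dual_eq_level => k u _.
  by rewrite pairing_dual_translation.
rewrite !big_ord_recl big_ord0 /= addr0.
have -> : dual_mode (omega U) 0 (dual_mode b (0 + (bump 0 0)%:Z) f) = 0.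
  apply: dual_eq_level => k u uk; rewrite pairing_dual_translation.
  case: k uk => [|[|k]] uk.
  - by rewrite (wt_neg _ (wt_L 1 (levelP _ _ uk))) ?linear0.
  - by rewrite quasi_primary ?linear0.
  - rewrite (dual_mode_level0 (k := k.+1) b1 f1) //.
    apply/levelP; move/levelP: uk => /(wt_L 1).
    by rewrite (_ : k.+2%:Z - 1 = k.+1%:Z) //; lia.
by rewrite scaler0 addr0 fact0 divr1 add0r addr0 expr1z scaleN1r.
Qed.

End DualModes.

Theorem lemma4p2 (R : realType) (U : voa R[i]) (r : diagonal_skew_tensor U)
    (quasi_primary : forall a : U, a \in level U 1 -> L 1 a = 0)
    (rota_baxter : voa_relative_rota_baxter 0 (tensor_map r)) :
  relative_rota_baxter (bracket U) (coadjoint U) (tensor_map_restrict r 1).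
Proof.
move=> f g; apply: val_inj.
(* The collapse [f(0) T(g) = - T(g)_0 f] turns the plus sign of the vertex identity into the minus
   sign of the Lie one. *)
rewrite /= rota_baxter dual_mode_right_level1 ?linearN //.
  exact: tensor_map_restrictP.
exact: (subspaceP f).
Qed.
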